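(* Let $p>5$ be a prime, let $n\ge 1$ be an integer, and let $G=C_{p^n}\times A_5$. Then $$\mathcal{V}(G)=\frac{33}{59(n+1)}.$$
   Context: For a finite group $G$, $L(G)$ denotes the set of all subgroups of $G$ (including the trivial subgroup and $G$ itself), $s(G)$ denotes the number of subgroups of $G$ that are simple groups (the trivial group is not simple; cyclic groups of prime order are simple), and $\mathcal{V}(G)=s(G)/|L(G)|$. Subgroups are counted as subsets of $G$. $C_m$ is the cyclic group of order $m$ and $A_5$ is the alternating group on 5 letters. *)

(* Defs.v *)
From mathcomp Require Import all_boot all_order all_fingroup all_algebra all_solvable.

Set Implicit Arguments.
Unset Strict Implicit.
Unset Printing Implicit Defensive.

Local Open Scope ring_scope.

Definition L (gT : finGroupType) (G : {group gT}) : {set {group gT}} :=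
  subgroups G.

(* [simple 1%g] is false, and groups of prime order are [simple]. *)
Definition s (gT : finGroupType) (G : {group gT}) : nat :=
  #|[set H in L G | simple H]|.

Definition V (gT : finGroupType) (G : {group gT}) : rat :=
  (s G)%:R / #|L G|%:R.

(* Main.v *)
(** A subgroup of a direct product of groups A and B of coprime orders is
    the product of its intersections with A and B; hence the number of subgroups is
    multiplicative, and since these intersections are normal in it, a simple
    subgroup lies in A or in B, so the number of simple subgroups is additive.
    The cyclic factor contributes n+1 subgroups, one of them simple. The
    counts 59 and 32 for A_5 are computed from its multiplication table: a
    list of subsets that starts with the trivial group and is closed under
    adjoining each element of the group in turn contains every subgroup, as
    soon as adjoining x to B yields a set between B u {x} and the subgroup
    generated by it. Discarding the sets that are not closed under
    multiplication then leaves exactly the subgroups. *)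
Require Import Defs.
From mathcomp Require Import all_boot all_order all_fingroup all_algebra all_solvable.

Set Implicit Arguments.
Unset Strict Implicit.
Unset Printing Implicit Defensive.

Local Open Scope group_scope.

(** * Isomorphism invariance of the two counts *)

Lemma isog_subgroups (gT rT : finGroupType) (G : {group gT}) (K : {group rT}) :
  G \isog K -> #|L G| = #|L K| /\ s G = s K.
Proof.
case/isogP=> f injf defK.
pose F (H : {group gT}) := (f @* H)%G.
have injF : {in L G &, injective F}.
  move=> H1 H2 /[!inE] sH1 sH2 /(congr1 val) /= eqF.
  by apply/val_inj/(injm_morphim_inj injf).
have imF : F @: L G = L K.
  apply/setP=> M; apply/imsetP/idP=> [[H Hin ->]|/[!inE] sMK].
    by move: Hin; rewrite !inE /= -defK; apply: morphimS.
  exists (f @*^-1 M)%G; first by rewrite inE subsetIl.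
  by apply/val_inj; rewrite /= morphpreK // defK.
split; first by rewrite -imF card_in_imset.
rewrite /s; suff ->: [set M in L K | simple M] = F @: [set H in L G | simple H].
  by rewrite card_in_imset // => H1 H2 /setIdP[LH1 _] /setIdP[LH2 _]; apply: injF.
have simF H : H \in L G -> simple (F H) = simple H.
  by rewrite inE => sHG; apply/esym/isog_simple/sub_isog.
apply/setP=> M; rewrite inE -imF; apply/andP/imsetP=> [[/imsetP[H LH ->]]|[H]].
  by rewrite simF // => simH; exists H; rewrite // inE LH.
by case/setIdP=> LH simH ->; rewrite simF // imset_f.
Qed.

(** * Cyclic groups of prime power order *)

(** In a cyclic group a subgroup is determined by its order, and the possible orders are the [p ^ k]
    with [k <= n]. *)
Lemma card_subgroups_cyclic_pgroup (gT : finGroupType) (G : {group gT}) p n :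
  prime p -> cyclic G -> #|G| = (p ^ n)%N -> #|L G| = n.+1.
Proof.
move=> pr_p cycG oG; rewrite -[RHS]card_ord.
(* The default value of [inord] never occurs on subgroups of [G], whose exponents are at most
   [n]. *)
pose ord_of (H : {group gT}) : 'I_n.+1 := inord (logn p #|H|).
have oH H : H \in L G -> exists2 k, k <= n & #|H| = (p ^ k)%N.
  by rewrite inE => /cardSg; rewrite oG => /(dvdn_pfactor _ _ pr_p).
have ordE H : H \in L G -> #|H| = (p ^ ord_of H)%N.
  by case/oH=> k le_kn oHk; rewrite /ord_of oHk pfactorK // inordK.
have inj_ord : {in L G &, injective ord_of}.
  move=> H K LH LK eqHK; apply/val_inj/eqP; move: (LH) (LK); rewrite !inE => sHG sKG.
  by rewrite (eq_subG_cyclic cycG) // ordE // eqHK -ordE.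
rewrite -(card_in_imset inj_ord); apply: eq_card => k; rewrite !inE.
have [x defG] := cyclicP cycG.
have ox : #[x] = (p ^ n)%N by rewrite orderE -defG.
have le_kn : k <= n by rewrite -ltnS.
have dv : (p ^ (n - k) %| #[x])%N by rewrite ox dvdn_exp2l ?leq_subr.
(* This power of a generator has order [p ^ n / p ^ (n - k) = p ^ k]. *)
apply/imsetP; exists <[x ^+ (p ^ (n - k))]>%G.
  by rewrite inE defG cycleX.
apply/val_inj; rewrite /= /ord_of -orderE orderXdiv // ox.
by rewrite -expnB ?prime_gt0 ?leq_subr // subKn // pfactorK // inordK.
Qed.

(** A simple subgroup of an abelian group has prime order, here necessarily [p]; Cauchy gives a
    subgroup of that order and cyclicity makes it unique. *)
Lemma num_simple_cyclic_pgroup (gT : finGroupType) (G : {group gT}) p n :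
  prime p -> cyclic G -> #|G| = (p ^ n.+1)%N -> s G = 1%N.
Proof.
move=> pr_p cycG oG; have [H sHG oH] : exists2 H : {group gT}, H \subset G & #|H| = p.
  have [x Gx ox] : {x | x \in G & #[x] = p} by apply: Cauchy; rewrite // oG dvdn_exp.
  by exists <[x]>%G; rewrite ?cycle_subG.
apply/eqP/cards1P; exists H; apply/setP=> K; rewrite !inE; apply/andP/eqP=> [[sKG]|->].
  have solK : solvable K := abelian_sol (abelianS sKG (cyclic_abelian cycG)).
  move/(simple_sol_prime solK) => pr_K; apply/val_inj/eqP.
  rewrite (eq_subG_cyclic cycG) // oH.
  by have := cardSg sKG; rewrite oG Euclid_dvdX // dvdn_prime2 // => /andP[].
have pr_H : prime #|H| by rewrite oH.
rewrite sHG; split=> //; apply/simpleP; split=> [|N nNH].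
  by rewrite -cardG_gt1 prime_gt1.
case: (eqVneq N 1%G) => [->|ntN]; [by left | right].
have := prime_meetG pr_H (H := N).
rewrite (setIidPr (normal_sub nNH)) => /(_ ntN) sHN.
by apply/eqP; rewrite eqEsubset (normal_sub nNH).
Qed.

(** * Direct products of groups of coprime orders *)

Section CoprimeDprod.

Variables (gT : finGroupType) (A B G : {group gT}).
Hypotheses (defG : A \x B = G) (coAB : coprime #|A| #|B|).

(** If [x = a * b] with [a] in [A] and [b] in [B], then [a] is the [\pi(A)]-constituent of [x],
    hence a power of [x]; so [H] contains [a] and [b] along with [x]. *)
Lemma coprime_dprod_sub (H : {group gT}) :
  H \subset G -> (H :&: A) * (H :&: B) = H.
Proof.
move=> sHG; have [_ defAB cAB _] := dprodP defG.
apply/eqP; rewrite eqEsubset mul_subG ?subsetIl //=.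
apply/subsetP=> x Hx; have: x \in A * B by rewrite defAB (subsetP sHG).
case/mulsgP=> a b Aa Bb def_x.
have cab : commute a b by apply/commute_sym/(centsP cAB).
have pi_a : \pi(A).-elt a := mem_p_elt (pgroup_pi A) Aa.
have pi'_b : \pi(A)^'.-elt b.
  by apply: mem_p_elt Bb; rewrite /pgroup -coprime_pi' ?cardG_gt0.
have xa : x.`_\pi(A) = a.
  by rewrite def_x consttM // (constt_p_elt pi_a) (constt1P pi'_b) mulg1.
have Ha : a \in H by rewrite -xa groupX.
have Hb : b \in H by rewrite -(mulKg a b) -def_x groupM ?groupV.
by rewrite def_x mem_mulg // inE ?Ha ?Hb.
Qed.

(** The map sending [(H, K)] to [H * K] is a bijection: the modular law recovers the factors as
    intersections with [A] and [B], and [coprime_dprod_sub] gives surjectivity. *)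
Lemma card_subgroups_coprime_dprod : #|L G| = (#|L A| * #|L B|)%N.
Proof.
have [_ defAB cAB tiAB] := dprodP defG.
have capl (H K : {group gT}) : H \subset A -> K \subset B -> (H * K) :&: A = H.
  move=> sHA sKB; have tiKA : K :&: A = 1.
    by apply/trivgP; rewrite -tiAB [A :&: B]setIC setSI.
  by rewrite -group_modl // tiKA mulg1.
have capr (H K : {group gT}) : H \subset A -> K \subset B -> (H * K) :&: B = K.
  move=> sHA sKB; have tiHB : H :&: B = 1 by apply/trivgP; rewrite -tiAB setSI.
  by rewrite setIC -group_modr // setIC tiHB mul1g.
have mulE (H K : {group gT}) : H \subset A -> K \subset B -> H <*> K = H * K.
  by move=> sHA sKB; rewrite cent_joinEr // (centSS sKB sHA).
rewrite -cardsX; pose F (HK : {group gT} * {group gT}) := (HK.1 <*> HK.2)%G.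
suff <- : F @: setX (L A) (L B) = L G.
  rewrite card_in_imset // => -[H1 K1] [H2 K2] /setXP[/= LH1 LK1] /setXP[/= LH2 LK2].
  move: LH1 LK1 LH2 LK2; rewrite !inE => sH1 sK1 sH2 sK2 /(congr1 val) /=.
  rewrite !mulE // => eqHK; congr pair; apply/val_inj => /=.
    by rewrite -(capl H1 K1) // eqHK capl.
  by rewrite -(capr H1 K1) // eqHK capr.
apply/setP=> H; apply/imsetP/idP=> [[[H1 K1]] /setXP[/=]|].
  rewrite !inE => sH1 sK1 ->; rewrite /= join_subG.
  have [/normal_sub sAG /normal_sub sBG] := dprod_normal2 defG.
  by rewrite (subset_trans sH1) // (subset_trans sK1).
rewrite inE => sHG; exists (H :&: A, H :&: B)%G.
  by rewrite !inE !subsetIr.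
by apply/val_inj; rewrite /= mulE ?subsetIr // coprime_dprod_sub.
Qed.

Lemma num_simple_coprime_dprod : s G = (s A + s B)%N.
Proof.
have [nsAG nsBG] := dprod_normal2 defG.
have [_ _ _ tiAB] := dprodP defG.
have simple_sub (H : {group gT}) : H \subset G -> simple H ->
    (H \subset A) || (H \subset B).
  move=> sHG /simpleP[ntH simH].
  have nsHI (N : {group gT}) : N <| G -> (H :&: N)%G <| H.
    exact: normalGI.
  have [HA|<-] := simH _ (nsHI A nsAG); last by rewrite subsetIr.
  have [HB|<-] := simH _ (nsHI B nsBG); last by rewrite subsetIr orbT.
  by case/eqP: ntH; rewrite -(coprime_dprod_sub sHG) HA HB mulg1.
(* Inclusion-exclusion: a subgroup of both [A] and [B] is trivial, hence not simple. *)
rewrite /s -cardsUI [X in (_ + X)%N](_ : _ = 0%N); last first.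
  apply: eq_card0 => H; rewrite !inE; apply/negP=> /andP[/andP[sHA simH] /andP[sHB _]].
  by case/simpleP: simH => /negP[]; rewrite -subG1 -tiAB subsetI sHA.
rewrite addn0; apply: eq_card=> H; rewrite !inE -andb_orl.
apply: andb_id2r => simH; apply/idP/idP=> [sHG|]; first exact: simple_sub.
by case/orP=> sH; apply: subset_trans sH (normal_sub _).
Qed.

End CoprimeDprod.

(** The external product is the internal direct product of [A x 1] and [1 x B], which are copies of
    [A] and [B]. *)
Lemma coprime_setX_subgroups (gT1 gT2 : finGroupType)
    (A : {group gT1}) (B : {group gT2}) :
    coprime #|A| #|B| ->
  #|L (setX_group A B)| = (#|L A| * #|L B|)%N /\ s (setX_group A B) = (s A + s B)%N.
Proof.
have isoA := isog_setX1 gT2 A; have isoB := isog_set1X gT1 B.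
have [-> ->] := isog_subgroups (K := setX_group A 1) isoA.
have [-> ->] := isog_subgroups (K := setX_group 1 B) isoB.
rewrite (card_isog isoA) (card_isog isoB) => coAB; split.
  exact: card_subgroups_coprime_dprod (setX_dprod A B) coAB.
exact: num_simple_coprime_dprod (setX_dprod A B) coAB.
Qed.

(** * Enumerating subgroups from a multiplication table *)

Section TableAlgorithm.

Variables (n : nat) (tab : seq (seq nat)).

(* Group elements are positions in an enumeration starting with 1, and a subset
   is the bit sequence of its characteristic function. *)
Definition tmul i j := nth 0 (nth [::] tab i) j.

Definition members (B : bitseq) : seq nat := mask B (iota 0 n).

Definition insert k (B : bitseq) : bitseq := set_nth false B k true.

Definition trivial_bits : bitseq := insert 0 (nseq n false).

(* If M lists a subgroup, the first component of the state is a union of right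
   cosets of M and the second lists the coset representatives still to be
   multiplied by x M; [visit] adds the coset of r y when it is new. *)
Definition visit (M : seq nat) r (st : bitseq * seq nat) y :=
  let k := tmul r y in
  if nth false st.1 k then st
  else (foldl (fun B m => insert (tmul m k) B) st.1 M, k :: st.2).

(** Once no representative is pending, the union of right cosets of a subgroup M is closed under
    right multiplication by x M, so it is the subgroup generated by M and x. Each round consumes one
    representative, and there are at most [n] cosets. *)
Fixpoint saturate fuel (M xM : seq nat) (st : bitseq * seq nat) : bitseq :=
  if fuel is fuel'.+1 then
    if st.2 is r :: rs then
      saturate fuel' M xM (foldl (visit M r) (st.1, rs) xM)
    else st.1
  else st.1.

(* Inserting x at the end is redundant when B is a subgroup, but makes the
   inclusion of x hold for every B and every amount of fuel. *)
Definition join_bits (B : bitseq) x : bitseq :=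
  if nth false B x then B else
  let M := members B in
  insert x (saturate n M [seq tmul x m | m <- M] (B, [:: 0])).

Definition candidates : seq bitseq :=
  foldl (fun L x => undup (L ++ [seq join_bits B x | B <- L]))
    [:: trivial_bits] (iota 0 n).

Definition closed_bits (B : bitseq) : bool :=
  let M := members B in
  nth false B 0 && all (fun i => all (fun j => nth false B (tmul i j)) M) M.

Definition subgroup_bits : seq bitseq := [seq B <- candidates | closed_bits B].

(** Normality is tested without inverses, as N h being contained in h N. *)
Definition normal_bits (C B : bitseq) : bool :=
  let N := members C in
  all (nth false B) N &&
  all (fun h => let hN := [seq tmul h i | i <- N] in
                all (fun i => tmul i h \in hN) N) (members B).

Definition simple_bits (L : seq bitseq) (B : bitseq) : bool :=
  (B != trivial_bits) &&
  all (fun C => normal_bits C B ==> (C == trivial_bits) || (C == B)) L.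

End TableAlgorithm.

(** * Correctness of the enumeration *)

Section TableCorrectness.

Variables (gT : finGroupType) (G : {group gT}) (e : seq gT).
Variable tab : seq (seq nat).
Local Notation n := (size e).
Local Notation "''e_' i" := (nth 1 e i) (at level 8, i at level 2, format "''e_' i").
Local Notation tmul := (tmul tab).
Hypotheses (e_uniq : uniq e) (mem_e : e =i G) (e0 : 'e_0 = 1).
Hypothesis tabE : forall i j, i < n -> j < n -> tmul i j = index ('e_i * 'e_j) e.

Definition bits (A : {set gT}) : bitseq := [seq x \in A | x <- e].

(** The bound matters: past the end of [e], ['e_i] defaults to 1, which lies in every subgroup. *)
Definition within (A : {set gT}) i := (i < n) && ('e_i \in A).

Definition sound (A : {set gT}) (B : bitseq) :=
  size B = n /\ forall i, nth false B i -> within A i.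

Lemma size_group_enum_gt0 : 0 < n.
Proof. by have := group1 G; rewrite -mem_e; case: (e). Qed.

Lemma nth_group_enum i : i < n -> 'e_i \in G.
Proof. by move=> lt_i; rewrite -mem_e mem_nth. Qed.

Lemma size_bits A : size (bits A) = n.
Proof. exact: size_map. Qed.

Lemma nth_bits A i : nth false (bits A) i = within A i.
Proof.
rewrite /within; case: ltnP => [lt_i|ge_i]; first by rewrite (nth_map 1).
by rewrite nth_default // size_bits.
Qed.

Lemma bits_inj (H K : {group gT}) :
  H \subset G -> K \subset G -> bits H = bits K -> H = K.
Proof.
move=> sHG sKG eqHK; apply/val_inj/setP => x /=.
have [Gx|notGx] := boolP (x \in G); last first.
  by rewrite (contraNF (subsetP sHG x)) // (contraNF (subsetP sKG x)).
have lt_x : index x e < n by rewrite index_mem mem_e.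
have /(congr1 (fun B => nth false B (index x e))) := eqHK.
by rewrite !nth_bits /within lt_x nth_index ?mem_e.
Qed.

Lemma mem_members B i :
  size B = n -> (i \in members n B) = nth false B i.
Proof.
move=> szB; rewrite /members -[in LHS](mkseq_nth false B) szB -filter_mask.
rewrite mem_filter mem_iota add0n /=.
by case: ltnP => [//|ge_i]; rewrite ?andbT // andbF nth_default // szB.
Qed.

Lemma nth_tmul i j : i < n -> j < n -> tmul i j < n /\ 'e_(tmul i j) = 'e_i * 'e_j.
Proof.
move=> lt_i lt_j; have Gij: 'e_i * 'e_j \in e by rewrite mem_e groupM ?nth_group_enum.
by rewrite tabE // index_mem nth_index.
Qed.

Lemma within_tmul (H : {group gT}) i j :
  within H i -> within H j -> within H (tmul i j).
Proof.
case/andP=> lt_i Hi /andP[lt_j Hj]; have [lt_ij eij] := nth_tmul lt_i lt_j.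
by rewrite /within lt_ij eij groupM.
Qed.

Lemma within0 (H : {group gT}) : within H 0.
Proof. by rewrite /within size_group_enum_gt0 e0 group1. Qed.

Lemma sound_insert A B k : sound A B -> within A k -> sound A (insert k B).
Proof.
move=> [szB sB] Ak; case/andP: (Ak) => lt_k _; split=> [|i].
  by rewrite size_set_nth szB; apply/maxn_idPr.
by rewrite nth_set_nth /=; case: eqP => [-> //|_]; apply: sB.
Qed.

Lemma sound_bits A : sound A (bits A).
Proof. by split=> [|i]; rewrite ?size_bits // nth_bits. Qed.

Lemma trivial_bitsE : trivial_bits n = bits 1.
Proof.
apply: (@eq_from_nth _ false) => [|i _].
  by rewrite size_bits size_set_nth size_nseq; apply/maxn_idPr/size_group_enum_gt0.
rewrite nth_bits nth_set_nth /= nth_nseq if_same /within inE.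
case: eqP => [->|/eqP i_neq0]; first by rewrite size_group_enum_gt0 e0 eqxx.
case: ltnP => //= lt_i; have := nth_uniq 1 lt_i size_group_enum_gt0 e_uniq.
by rewrite e0 (negbTE i_neq0).
Qed.

Lemma sound_subset (A A' : {set gT}) B : A \subset A' -> sound A B -> sound A' B.
Proof.
move=> sAA' [szB sB]; split=> // i /sB /andP[lt_i Ai].
by rewrite /within lt_i (subsetP sAA').
Qed.

Lemma sound_visit (H : {group gT}) M r st y :
    all (within H) M -> within H r -> within H y ->
    sound H st.1 -> all (within H) st.2 ->
  let st' := visit tab M r st y in sound H st'.1 /\ all (within H) st'.2.
Proof.
case: st => B rs /= HM Hr Hy HB Hrs; rewrite /visit /=.
case: ifP => //= _; have Hk := within_tmul Hr Hy; split; last by rewrite Hk.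
elim: M B HM HB => //= m M IHM B /andP[Hm HM] HB.
by apply: IHM => //; apply: sound_insert (within_tmul Hm Hk).
Qed.

Lemma sound_saturate (H : {group gT}) fuel M xM st :
    all (within H) M -> all (within H) xM ->
    sound H st.1 -> all (within H) st.2 ->
  sound H (saturate tab fuel M xM st).
Proof.
move=> HM HxM; elim: fuel st => [|fuel IH] [B [|r rs]] //= HB /andP[Hr Hrs].
have [] : let st' := foldl (visit tab M r) (B, rs) xM in
    sound H st'.1 /\ all (within H) st'.2; last exact: IH.
have: sound H (B, rs).1 by []. have: all (within H) (B, rs).2 by [].
elim: {IH} xM (B, rs) HxM {HB Hrs} => //= y xM IHx st /andP[Hy HxM] Hrs HB.
by have [] := sound_visit HM Hr Hy HB Hrs => HB' Hrs'; apply: IHx.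
Qed.

(** Only products of elements of [H] are ever inserted. As [H] is any subgroup containing [B] and
    [x], the join stays inside the subgroup they generate. *)
Lemma sound_join (H : {group gT}) B x :
  sound H B -> within H x -> sound H (join_bits n tab B x).
Proof.
move=> HB Hx; rewrite /join_bits; case: ifP => // _.
have HM : all (within H) (members n B).
  by apply/allP=> i; rewrite mem_members => [|]; [apply: HB.2 | exact: HB.1].
apply: sound_insert => //; apply: sound_saturate => //=; last by rewrite within0.
by apply/allP=> _ /mapP[m /(allP HM) Hm ->]; apply: within_tmul.
Qed.

Lemma visit_sub M r st y i :
  nth false st.1 i -> nth false (visit tab M r st y).1 i.
Proof.
case: st => B rs /=; rewrite /visit; case: ifP => //= _.
elim: M B => //= m M IHM B Bi; apply: IHM.
by rewrite nth_set_nth /=; case: eqP.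
Qed.

Lemma saturate_sub fuel M xM st i :
  nth false st.1 i -> nth false (saturate tab fuel M xM st) i.
Proof.
elim: fuel st => [|fuel IH] [B [|r rs]] //= Bi; apply: IH.
have: nth false (B, rs).1 i by [].
by elim: xM (B, rs) => //= y xM IHx st sti; apply/IHx/visit_sub.
Qed.

(** The lower bound matching [sound_join]: bits are only ever switched on. *)
Lemma join_sub B x i :
  nth false B i || (i == x) -> nth false (join_bits n tab B x) i.
Proof.
rewrite /join_bits; case: ifP => [Bx /orP[//|/eqP->//]|_].
rewrite nth_set_nth /=; case: eqP => //= _; rewrite orbF.
exact: (@saturate_sub _ _ _ (B, [:: 0])).
Qed.

Lemma candidates_sound B : B \in candidates n tab -> sound G B.
Proof.
have: {in [:: trivial_bits n], forall B, sound G B}.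
  move=> _ /[!inE] /eqP->; rewrite trivial_bitsE.
  exact: sound_subset (sub1G G) (sound_bits 1).
have: {subset iota 0 n <= gtn n} by move=> i; rewrite mem_iota.
rewrite /candidates; elim: (iota 0 n) [:: _] => [|x s IH] L //= ltn LG.
  exact: LG.
apply: IH => [i si|C]; first by apply: ltn; rewrite inE si orbT.
rewrite mem_undup mem_cat => /orP[/LG //|/mapP[D LD ->]].
have lt_x : x < n by apply: ltn; rewrite inE eqxx.
by apply: sound_join; [exact: LG | rewrite /within lt_x nth_group_enum].
Qed.

(* After the points of a prefix of [e] have been treated, some candidate lies
   between the trace of [H] on that prefix and [H]. *)
Lemma bits_in_candidates (H : {group gT}) :
  H \subset G -> bits H \in candidates n tab.
Proof.
move=> sHG; suff [B LB [[szB sHB] HB]] : exists2 B, B \in candidates n tab &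
    sound H B /\ forall i, within H i -> i \in iota 0 n -> nth false B i.
  suff ->: bits H = B by [].
  apply: (@eq_from_nth _ false) => [|i]; rewrite size_bits ?szB // => lt_i.
  rewrite nth_bits; apply/idP/idP => [Hi|/sHB //].
  by apply: HB; rewrite ?mem_iota.
rewrite /candidates; elim/last_ind: (iota 0 n) => [|s x [B LB [HB sHB]]] /=.
  exists (trivial_bits n); rewrite ?inE //; split=> //.
  rewrite trivial_bitsE; exact: sound_subset (sub1G H) (sound_bits 1).
rewrite foldl_rcons; have [Hx|notHx] := boolP (within H x).
  exists (join_bits n tab B x).
    by rewrite mem_undup mem_cat; apply/orP; right; apply/mapP; exists B.
  split=> [|i Hi]; first exact: sound_join.
  rewrite mem_rcons inE orbC => si; apply: join_sub.
  by case/orP: si => [/(sHB i Hi) ->|->]; rewrite ?orbT.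
exists B; first by rewrite mem_undup mem_cat LB.
split=> // i Hi; rewrite mem_rcons inE => /orP[/eqP xi|]; last exact: sHB.
by rewrite -xi Hi in notHx.
Qed.

Lemma members_bits A i : (i \in members n (bits A)) = within A i.
Proof. by rewrite mem_members ?size_bits ?nth_bits. Qed.

Lemma closed_bits_group (H : {group gT}) : closed_bits n tab (bits H).
Proof.
rewrite /closed_bits nth_bits within0 /=.
apply/allP=> i /[!members_bits] Hi; apply/allP=> j /[!members_bits] Hj.
by rewrite nth_bits within_tmul.
Qed.

(** In a finite group, containing 1 and being closed under products already makes a subset a
    subgroup. *)
Lemma group_of_closed_bits B : sound G B -> closed_bits n tab B ->
  exists2 H : {group gT}, H \subset G & B = bits H.
Proof.
move=> [szB sGB] /andP[B0 /allP mulB].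
pose A := [set x in G | nth false B (index x e)].
have gA : group_set A.
  apply/group_setP; split=> [|x y].
    by rewrite inE group1 -e0 index_uniq ?size_group_enum_gt0.
  rewrite !inE => /andP[Gx Bx] /andP[Gy By]; rewrite groupM //=.
  move: (mulB (index x e)); rewrite mem_members // => /(_ Bx) /allP.
  move/(_ (index y e)); rewrite mem_members // => /(_ By).
  by rewrite tabE ?index_mem ?mem_e // !nth_index ?mem_e.
exists (group gA); first by apply/subsetP=> x /[!inE] /andP[].
apply: (@eq_from_nth _ false) => [|i]; rewrite szB ?size_bits // => lt_i.
by rewrite nth_bits /within inE lt_i nth_group_enum // index_uniq.
Qed.

Lemma subgroup_bitsP B :
  reflect (exists2 H : {group gT}, H \subset G & B = bits H)
          (B \in subgroup_bits n tab).
Proof.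
rewrite mem_filter; apply: (iffP andP) => [[clB /candidates_sound soB]|].
  exact: group_of_closed_bits.
by case=> H sHG ->; rewrite closed_bits_group bits_in_candidates.
Qed.

Lemma normal_bitsE (N H : {group gT}) :
  N \subset G -> H \subset G -> normal_bits n tab (bits N) (bits H) = (N <| H).
Proof.
move=> sNG sHG; have idx (K : {group gT}) x : K \subset G -> x \in K ->
    [/\ index x e < n, 'e_(index x e) = x & within K (index x e)].
  move=> sKG Kx; have Gx : x \in e by rewrite mem_e (subsetP sKG).
  by rewrite /within index_mem Gx nth_index.
rewrite /normal_bits /normal; apply/andP/andP=> -[]; last first.
  move=> sNH nNH; split.
    apply/allP=> i /[!members_bits] /andP[lt_i Ni].
    by rewrite nth_bits /within lt_i (subsetP sNH).
  apply/allP=> h /[!members_bits] /andP[lt_h Hh].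
  apply/allP=> i /[!members_bits] /andP[lt_i Ni].
  have Nih : 'e_i ^ 'e_h \in N by rewrite memJ_norm // (subsetP nNH).
  have [ltk ek Nk] := idx N _ sNG Nih.
  (* The witness comes from the identity [x * y = y * x ^ y]. *)
  apply/mapP; exists (index ('e_i ^ 'e_h) e); first by rewrite members_bits.
  by rewrite !tabE // ek -conjgC.
move=> /allP sNH /allP nNH; split.
  apply/subsetP=> x Nx; have [_ ex Nex] := idx N x sNG Nx.
  have := sNH (index x e); rewrite members_bits nth_bits => /(_ Nex) /andP[_].
  by rewrite ex.
apply/subsetP=> h Hh; rewrite inE; apply/subsetP=> _ /imsetP[x Nx ->].
have [lt_x ex Nex] := idx N x sNG Nx; have [lt_h eh Heh] := idx H h sHG Hh.
have /allP := nNH (index h e) (etrans (members_bits _ _) Heh).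
move/(_ (index x e) (etrans (members_bits _ _) Nex)) => /mapP[j].
(* Reading the equality of positions back in the group gives [x * h = h * 'e_j], so [x ^ h] is
   ['e_j]. *)
rewrite members_bits => /andP[lt_j Nj] /(congr1 (nth 1 e)).
rewrite !(nth_tmul _ _).2 // ex eh => def_xh.
by rewrite conjgE def_xh mulKg.
Qed.

Lemma simple_bitsE (H : {group gT}) :
  H \subset G -> simple_bits n tab (subgroup_bits n tab) (bits H) = simple H.
Proof.
move=> sHG; rewrite /simple_bits trivial_bitsE.
have bits_eq (K K' : {group gT}) :
    K \subset G -> K' \subset G -> (bits K == bits K') = (K :==: K').
  move=> sK sK'; apply/eqP/eqP=> [/(bits_inj sK sK') ->|eqKK'] //.
  by rewrite eqKK'.
have triv_eq (K : {group gT}) : K \subset G -> (bits K == bits 1) = (K :==: 1).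
  by move=> sK; rewrite (bits_eq K 1%G) ?sub1G.
rewrite triv_eq //; apply/andP/simpleP=> [[ntH /allP simH]|[ntH simH]].
  split=> // N nNH.
  have sNG := subset_trans (normal_sub nNH) sHG.
  have /simH : bits N \in subgroup_bits n tab by apply/subgroup_bitsP; exists N.
  by rewrite normal_bitsE // nNH triv_eq // bits_eq // => /orP[]/eqP; [left|right].
split=> //; apply/allP=> _ /subgroup_bitsP[N sNG ->]; rewrite normal_bitsE //.
by apply/implyP=> /simH[] NE; rewrite triv_eq // bits_eq // NE eqxx ?orbT.
Qed.

(** Both lists are free of duplicates, so lengths and counts on the computed list are cardinals of
    sets of subgroups. *)
Lemma perm_subgroup_bits :
  perm_eq (subgroup_bits n tab) [seq bits H | H : {group gT} <- enum (subgroups G)].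
Proof.
apply: uniq_perm => [||B].
- apply: filter_uniq; rewrite /candidates.
  by elim/last_ind: (iota 0 n) => // s x _; rewrite foldl_rcons undup_uniq.
- rewrite map_inj_in_uniq ?enum_uniq // => H K.
  by rewrite !mem_enum !inE => sH sK; apply: bits_inj.
apply/subgroup_bitsP/mapP=> -[H].
  by exists H; rewrite ?mem_enum ?inE.
by rewrite mem_enum inE => sHG ->; exists H.
Qed.

Lemma card_subgroups_table : #|L G| = size (subgroup_bits n tab).
Proof. by rewrite (perm_size perm_subgroup_bits) size_map cardE. Qed.

Lemma num_simple_table :
  s G = let L := subgroup_bits n tab in count (simple_bits n tab L) L.
Proof.
rewrite /= (seq.permP perm_subgroup_bits) count_map -size_filter.
rewrite -(card_uniqP (filter_uniq _ (enum_uniq _))).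
apply: eq_card => H; rewrite inE mem_filter mem_enum andbC.
by apply: andb_id2r => /[!inE] sHG; rewrite /= simple_bitsE.
Qed.

End TableCorrectness.

(** * The multiplication table of A_5 and its counts *)

Local Notation o k := (Ordinal (isT : (k < 5)%N)).

(** One-line notation in plain natural numbers, on which the table can be evaluated efficiently. *)
Definition perm_code (x : 'S_5) : seq nat :=
  [:: x (o 0) : nat; x (o 1) : nat; x (o 2) : nat; x (o 3) : nat; x (o 4) : nat].

(** Products of permutations act from left to right, so the left code is read first. *)
Definition code_mul (l k : seq nat) : seq nat := [seq nth 0 k i | i <- l].

Lemma perm_code_inj : injective perm_code.
Proof.
move=> x y [] e0 e1 e2 e3 e4; apply/permP=> -[[|[|[|[|[|//]]]]] lt_i];
  by apply/val_inj; rewrite (bool_irrelevance lt_i isT).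
Qed.

Lemma nth_perm_code x (i : 'I_5) : nth 0 (perm_code x) i = x i.
Proof.
by case: i => [[|[|[|[|[|//]]]]] lt_i] /=; congr (nat_of_ord (x _)); apply: val_inj.
Qed.

Lemma perm_codeM x y : perm_code (x * y) = code_mul (perm_code x) (perm_code y).
Proof. by rewrite /code_mul /perm_code /= -/(perm_code y) !nth_perm_code !permM. Qed.

(* A_5 = C_5 C_3 V_4, with the Klein group V_4 generated by u and v. *)
Definition products (T : Type) (mul : T -> T -> T) (one c t u v : T) : seq T :=
  let pw x k := iter k (mul x) one in
  [seq mul x y | x <- [seq pw c i | i <- iota 0 5],
     y <- [seq mul x y | x <- [seq pw t i | i <- iota 0 3],
       y <- [seq mul x y | x <- [seq pw u i | i <- iota 0 2],
                           y <- [seq pw v i | i <- iota 0 2]]]].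

(** With the left factor acting first, this sends 0 to 1, 1 to 2, and so on, and 4 to 0. Products of
    transpositions make the parity immediate. *)
Definition cycle5 : 'S_5 :=
  tperm (o 0) (o 1) * tperm (o 0) (o 2) * tperm (o 0) (o 3) * tperm (o 0) (o 4).
Definition cycle3 : 'S_5 := tperm (o 0) (o 1) * tperm (o 0) (o 2).
Definition double01 : 'S_5 := tperm (o 0) (o 1) * tperm (o 2) (o 3).
Definition double02 : 'S_5 := tperm (o 0) (o 2) * tperm (o 1) (o 3).

Definition alt5_seq : seq 'S_5 := products *%g 1 cycle5 cycle3 double01 double02.

Definition alt5_codes : seq (seq nat) :=
  products code_mul [:: 0; 1; 2; 3; 4]%N
    [:: 1; 2; 3; 4; 0]%N [:: 1; 2; 0; 3; 4]%N [:: 1; 0; 3; 2; 4]%N [:: 2; 3; 0; 1; 4]%N.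

Definition alt5_table : seq (seq nat) :=
  [seq [seq index (code_mul a b) alt5_codes | b <- alt5_codes] | a <- alt5_codes].

Lemma perm_codes :
  [/\ perm_code 1 = [:: 0; 1; 2; 3; 4]%N, perm_code cycle5 = [:: 1; 2; 3; 4; 0]%N,
      perm_code cycle3 = [:: 1; 2; 0; 3; 4]%N, perm_code double01 = [:: 1; 0; 3; 2; 4]%N
    & perm_code double02 = [:: 2; 3; 0; 1; 4]%N].
Proof. by rewrite /perm_code; split; rewrite !(permM, permE). Qed.

Lemma map_products (T U : Type) (f : T -> U) mulT mulU one c t u v :
    {morph f : x y / mulT x y >-> mulU x y} ->
  [seq f x | x <- products mulT one c t u v] =
  products mulU (f one) (f c) (f t) (f u) (f v).
Proof. by move=> fM; rewrite /products /= !fM. Qed.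

Lemma perm_code_alt5 : [seq perm_code x | x <- alt5_seq] = alt5_codes.
Proof.
rewrite (map_products _ _ _ _ _ perm_codeM).
by case: perm_codes => -> -> -> -> ->.
Qed.

Lemma alt5_seq_uniq : uniq alt5_seq.
Proof. by rewrite -(map_inj_uniq perm_code_inj) perm_code_alt5; vm_compute. Qed.

Lemma card_alt5 : #|'Alt_('I_5)| = 60.
Proof. by apply/eqP; rewrite -(eqn_pmul2l (m := 2)) // card_Alt card_ord. Qed.

(** The list consists of 60 distinct even permutations, and A_5 has order 60. *)
Lemma alt5_seqE : alt5_seq =i 'Alt_('I_5).
Proof.
have sub_alt : {subset alt5_seq <= 'Alt_('I_5)}.
  have c : cycle5 \in 'Alt_('I_5) by rewrite Alt_even !odd_permM !odd_tperm.
  have t : cycle3 \in 'Alt_('I_5) by rewrite Alt_even !odd_permM !odd_tperm.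
  have u : double01 \in 'Alt_('I_5) by rewrite Alt_even !odd_permM !odd_tperm.
  have v : double02 \in 'Alt_('I_5) by rewrite Alt_even !odd_permM !odd_tperm.
  have pw x k : x \in 'Alt_('I_5) ->
      {subset [seq iter i ( *%g x) 1 | i <- iota 0 k] <= 'Alt_('I_5)}.
    move=> Ax _ /mapP[i _ ->]; elim: i => [|i IHi] /=; first exact: group1.
    exact: groupM.
  have pairs r1 r2 : {subset r1 <= 'Alt_('I_5)} -> {subset r2 <= 'Alt_('I_5)} ->
      {subset [seq x * y | x <- r1, y <- r2] <= 'Alt_('I_5)}.
    move=> s1 s2 _ /allpairsP[[x y] /= [r1x r2y ->]].
    by apply: groupM; [apply: s1 | apply: s2].
  by do 3?[apply: (pairs); first exact: pw]; apply: pw.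
apply/subset_cardP; last exact/subsetP.
by rewrite card_alt5; apply/card_uniqP/alt5_seq_uniq.
Qed.

Lemma alt5_tableE i j : i < size alt5_seq -> j < size alt5_seq ->
  tmul alt5_table i j = index (nth 1 alt5_seq i * nth 1 alt5_seq j) alt5_seq.
Proof.
move=> lt_i lt_j; rewrite -(index_map perm_code_inj) perm_codeM perm_code_alt5.
rewrite -!(nth_map 1 [::] perm_code) ?perm_code_alt5 //.
have szE : size alt5_codes = size alt5_seq by rewrite -perm_code_alt5 size_map.
by rewrite /tmul (nth_map [::]) ?szE // (nth_map [::]) ?szE.
Qed.

Lemma alt5_seq0 : nth 1 alt5_seq 0 = 1.
Proof. by rewrite /= !mulg1. Qed.

Lemma size_alt5_seq : size alt5_seq = 60.
Proof. by rewrite -(size_map perm_code) perm_code_alt5. Qed.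

(** The 32 simple subgroups are 15 of order 2, 10 of order 3, 6 of order 5, and A_5 itself. One list
    serves both counts. *)
Lemma alt5_counts : let L := subgroup_bits 60 alt5_table in
  (size L == 59) && (count (simple_bits 60 alt5_table L) L == 32).
Proof. by vm_compute. Qed.

Lemma alt5_subgroups : #|L 'Alt_('I_5)| = 59 /\ s 'Alt_('I_5) = 32.
Proof.
have /andP[/eqP oL /eqP sL] := alt5_counts.
rewrite (card_subgroups_table alt5_seq_uniq alt5_seqE alt5_seq0 alt5_tableE).
rewrite (num_simple_table alt5_seq_uniq alt5_seqE alt5_seq0 alt5_tableE).
by rewrite size_alt5_seq; split; [exact: oL | exact: sL].
Qed.

(* The value of V for the product *)
Local Close Scope group_scope.
Local Open Scope ring_scope.

Theorem proposition2p4 (p n : nat) (gT : finGroupType) (G : {group gT})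
    (hp : prime p) (hp5 : (5 < p)%N) (hn : (1 <= n)%N)
    (hG : G \isog setX (Zp (p ^ n)%N) ('Alt_('I_5))%g) :
  V G = 33%:R / (59%:R * (n%:R + 1)).
Proof.
(* [Zp] is defined by cases on whether its modulus exceeds 1. *)
have pn_gt1 : (1 < p ^ n)%N by rewrite -(exp1n n) ltn_exp2r // prime_gt1.
pose C := Zp_group (p ^ n); pose A := ('Alt_('I_5))%G.
have oC : #|C| = (p ^ n)%N by rewrite card_Zp // ltnW.
have cycC : cyclic C by rewrite /= /Zp pn_gt1 Zp_cycle cycle_cyclic.
have oA : #|A| = 60%N by rewrite card_alt5.
have coCA : coprime #|C| #|A|.
  rewrite oC oA coprime_pexpl // prime_coprime //.
  (* The prime divisors of 60 are 2, 3 and 5, all excluded by [hp5]. *)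
  apply/negP=> p_dvd60; have : p \in primes 60 by rewrite mem_primes hp.
  by rewrite !inE => /or3P[] /eqP p_eq; rewrite p_eq in hp5.
have [LG sG] := isog_subgroups hG.
have [LCA sCA] := coprime_setX_subgroups coCA.
have [LA sA] := alt5_subgroups.
have LC : #|L C| = n.+1 := card_subgroups_cyclic_pgroup hp cycC oC.
have sC : s C = 1%N.
  by apply: (num_simple_cyclic_pgroup (n := n.-1) hp cycC); rewrite prednK.
(* The numerator is 1 + 32 and the denominator [n.+1 * 59], so nothing has to be cancelled. *)
by rewrite /V LG sG LCA sCA LC sC LA sA mulnC GRing.natrM (GRing.natr1 _ n).
Qed.
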